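(* Let $n\ge 2$, let $F$ be a field of order greater than $2$, let $\Sigma_{n+1}$ be the $(n+1)$-dimensional projective space over $F$, and let $H=\Sigma_n$ be a hyperplane of $\Sigma_{n+1}$. Let $\Gamma=\{1,2,\ldots,n+3\}$ be an arc of $n+3$ points in $\Sigma_{n+1}$, none of which lies in $H$. For distinct $i,j$ let $(i,j)=(j,i)$ denote the point in which the line joining $i$ and $j$ meets $H$. Then each of the $\binom{n+3}{2}$ points $(i,j)$ of this configuration is a vertex of perspectivity for a pair of simplexes of $H$ having no points or faces in common.
   Context: Dimension means projective dimension. A simplex in an $m$-dimensional projective space is a set of $m+1$ points that generates the space; its faces are the hyperplanes generated by $m$ of its points. An arc in $\Sigma_{n+1}$ is a set of at least $n+2$ points such that every subset of size $n+2$ is a simplex. A point $V$ is the vertex of perspectivity of simplexes $\{A_1,\ldots,A_{n+1}\}$ and $\{B_1,\ldots,B_{n+1}\}$ in $H$ if there are $n+1$ lines through $V$, the $i$-th one containing $A_i$ and $B_i$. *)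

(* Defs.v *)
From mathcomp Require Import all_boot all_order all_algebra.
From mathcomp Require Import finmap.

Set Implicit Arguments.
Unset Strict Implicit.
Unset Printing Implicit Defensive.

(* The projective space of dimension m over F is represented by a vector space
   of dimension m + 1 over F: a subspace of projective dimension d is a
   {vspace V} of vector dimension d + 1, incidence is inclusion, the join is
   (_ + _)%VS and the intersection is (_ :&: _)%VS.  Hence a projective space U
   of projective dimension m has \dim U = m + 1.  Finite sets of points are
   duplicate-free sequences. *)
Section Projective.

Variables (F : fieldType) (V : vectType F).
Implicit Types (U W H P L : {vspace V}) (s t : seq {vspace V}).

Definition is_point P := \dim P = 1.

Definition is_line L := \dim L = 2.

Definition generated s : {vspace V} := (\sum_(P <- s) P)%VS.

Definition point_set s := uniq s /\ (forall P, P \in s -> is_point P).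

Definition is_simplex U s :=
  [/\ point_set s, size s = \dim U & generated s = U].

Definition is_face s W :=
  exists t, [/\ uniq t, {subset t <= s}, (size t).+1 = size s
              & W = generated t].

Definition is_arc U s :=
  [/\ point_set s, \dim U <= size s
    & forall t, uniq t -> {subset t <= s} -> size t = \dim U ->
        is_simplex U t].

Definition vertex_of_perspectivity k P (A B : k.-tuple {vspace V}) :=
  is_point P /\
  exists L : 'I_k -> {vspace V},
    injective L /\
    (forall i, [/\ is_line (L i), (P <= L i)%VS, (tnth A i <= L i)%VS
                 & (tnth B i <= L i)%VS]).

Definition no_common_points s t := forall P, P \in s -> P \notin t.

Definition no_common_faces s t := forall W, is_face s W -> ~ is_face t W.

(* The point (i, j) of the configuration cut out on H by the points of G. *)
Definition config_point H k (G : k.-tuple {vspace V}) (i j : 'I_k) :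
  {vspace V} := ((tnth G i + tnth G j) :&: H)%VS.

Definition configuration H k (G : k.-tuple {vspace V}) : {fset {vspace V}} :=
  [fset config_point H G p.1 p.2 | p : 'I_k * 'I_k & p.1 != p.2]%fset.

End Projective.

(* Main.v *)
(* Rescale a vector g_i spanning each point i of the arc so that all the
   differences g_i - g_j lie in H; then (i, j) = <g_i - g_j>.  Given i <> j,
   take the simplexes A_k = (i, k) and B_k = (j, k) for k distinct from i and
   j: the line joining (i, j) and (i, k) contains (j, k).  A common face of A
   and B contains both (i, m) and (j, m) for some m, as n >= 2, hence also
   (i, j); but then the n + 1 points of the arc other than j and the k omitted
   from A span j. *)
Require Import Defs.
From mathcomp Require Import all_boot all_order all_algebra.
From mathcomp Require Import finmap.

Set Implicit Arguments.
Unset Strict Implicit.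
Unset Printing Implicit Defensive.

Import GRing.Theory.

(** * Differences of the vectors of a family from one vector *)

Section SpanDifferences.

Local Open Scope ring_scope.

Variables (F : fieldType) (V : vectType F).
Implicit Types (v : V) (s : seq V).

(** The map sending [w] to [v - w] is an involution, so each inclusion follows by the same
    argument. *)
Lemma span_cons_sub v s :
  (<<v :: [seq v - w | w <- s]>> = <<v :: s>>)%VS.
Proof.
apply/eqP; rewrite eqEsubv; apply/andP; split; apply/span_subvP => x.
  rewrite inE => /predU1P[->|/mapP[w sw ->]]; first by rewrite memv_span ?mem_head.
  by rewrite memvB ?memv_span ?mem_head // inE sw orbT.
rewrite inE => /predU1P[->|sx]; first by rewrite memv_span ?mem_head.
rewrite -[x](subKr v) memvB ?memv_span ?mem_head //.
by rewrite inE (map_f (fun w => v - w)) ?orbT.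
Qed.

(** Replacing the tail by differences changes neither the span nor the length, hence keeps freeness;
    then [v] is dropped. *)
Lemma free_map_sub v s : free (v :: s) -> free [seq v - w | w <- s].
Proof.
move=> fr; suff: free (v :: [seq v - w | w <- s]) by rewrite free_cons => /andP[].
by rewrite /free span_cons_sub (eqP fr) /= size_map.
Qed.

End SpanDifferences.

(** Pairs are grouped by their larger entry [j], which has exactly [j] smaller partners. *)
Lemma card_ord_pairs n : #|[pred p : 'I_n * 'I_n | p.1 < p.2]| = 'C(n, 2).
Proof.
rewrite -sum1_card -bin2_sum big_mkord /=.
rewrite (eq_bigr (fun j : 'I_n => \sum_(i < n | i < j) 1)); last first.
  move=> j _; rewrite -(big_ord_widen n (fun=> 1)) ?(ltnW (ltn_ord j)) //.
  by rewrite sum1_card card_ord.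
rewrite (exchange_big_dep predT) //= pair_big_dep /=.
by apply: eq_bigl => -[i j].
Qed.

(** * Points of H spanned by differences of arc representatives *)

Section ArcDifferences.

Local Open Scope ring_scope.

Variables (F : fieldType) (V : vectType F) (n : nat) (H : {vspace V}).
Variable g : 'I_n.+3 -> V.
Implicit Types (i j k l : 'I_n.+3) (s : seq 'I_n.+3) (W : {vspace V}).
Hypothesis n_ge2 : (2 <= n)%N.
Hypothesis dimH : \dim H = n.+1.
Hypothesis free_g : forall s, uniq s -> (size s <= n.+2)%N -> free (map g s).
Hypothesis sub_g : forall i j, g i - g j \in H.

Let pt i j : {vspace V} := <[g i - g j]>%VS.

(** With [i], the distinct entries of [s] give at most n+2 independent vectors. Repetitions in [s]
    are allowed, so that later uses need not separate coinciding indices. *)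
Lemma arc_notin_span i s :
  i \notin s -> (size s <= n.+1)%N -> g i \notin <<map g s>>%VS.
Proof.
move=> s'i le_s; have eqs: map g s =i map g (undup s).
  by move=> x; apply/mapP/mapP => -[j sj ->]; exists j; rewrite ?mem_undup // -mem_undup.
have: free (map g (i :: undup s)).
  apply: free_g; first by rewrite /= mem_undup s'i undup_uniq.
  by rewrite ltnS (leq_trans (size_undup s)).
by rewrite /= free_cons (eq_span eqs) => /andP[].
Qed.

Lemma free_arc_sub i s :
  i \notin s -> uniq s -> (size s <= n.+1)%N -> free [seq g i - g k | k <- s].
Proof.
move=> s'i uniq_s le_s; rewrite (map_comp (fun w => g i - w) g).
by apply: free_map_sub; apply: (free_g (s := i :: s)) => //=; rewrite s'i.
Qed.

Lemma arc_sub_neq0 i j : i != j -> g i - g j != 0.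
Proof.
move=> ij; have := @free_arc_sub i [:: j] _ isT isT.
by rewrite inE ij => /(_ isT); rewrite /= free_cons span_nil memv0 => /andP[].
Qed.

Lemma pt_sym i j : pt i j = pt j i.
Proof.
by apply/eqP; rewrite eqEsubv -!memvE -[in X in X && _]opprB
  -[in X in _ && X]opprB !memvN !memv_line.
Qed.

(** Otherwise [g i = (g i - g j) + g j] would lie in the span of [g j], [g k] and [g l]; three
    indices are within the bound n+1 because n is at least 2. *)
Lemma pt_mem i j k l : i != j -> pt i j = pt k l -> i \in [:: k; l].
Proof.
move=> ij eq_p; apply: contraT => kl'i.
have /negP : g i \notin <<map g [:: j; k; l]>>%VS.
  by apply: arc_notin_span; rewrite // inE negb_or ij.
case; rewrite -(subrK (g j) (g i)); apply: memvD; last by rewrite memv_span ?mem_head.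
have: g i - g j \in pt k l by rewrite -eq_p memv_line.
by case/vlineP => c ->; rewrite memvZ // memvB // memv_span // !inE eqxx ?orbT.
Qed.

Lemma pt_inj i j k l :
  i != j -> pt i j = pt k l -> ((i, j) == (k, l)) || ((i, j) == (l, k)).
Proof.
move=> ij eq_p; have := pt_mem ij eq_p.
have := pt_mem (i := j) (j := i) (k := k) (l := l).
rewrite eq_sym ij pt_sym => /(_ isT eq_p); rewrite !inE !xpair_eqE.
case/orP=> /eqP jE /orP[] /eqP iE; move: ij; rewrite iE jE !eqxx ?orbT //.
Qed.

Lemma generated_pt i s :
  generated (map (pt i) s) = <<[seq g i - g k | k <- s]>>%VS.
Proof. by rewrite /generated span_def !big_map. Qed.

Lemma pt_star_inj i s : i \notin s -> {in s &, injective (pt i)}.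
Proof.
move=> s'i k l sk sl eq_p; have ik : i != k by apply: contraNneq s'i => ->.
have := pt_inj ik eq_p; rewrite !xpair_eqE eqxx /=.
case/orP=> [/eqP //|/andP[/eqP il _]].
by move: s'i; rewrite il sl.
Qed.

Lemma is_point_pt i j : i != j -> is_point (pt i j).
Proof. by move=> ij; rewrite /is_point dim_vline arc_sub_neq0. Qed.

(** The n+1 differences are independent and lie in [H], whose vector dimension is n+1, so they span
    it. *)
Lemma pt_star_simplex i s :
  i \notin s -> uniq s -> size s = n.+1 -> is_simplex H (map (pt i) s).
Proof.
move=> s'i uniq_s size_s; split; last 1 first.
- rewrite generated_pt; apply/eqP; rewrite eqEdim dimH; apply/andP; split.
    by apply/span_subvP => _ /mapP[k _ ->].
  have := @free_arc_sub i s s'i uniq_s; rewrite size_s => /(_ (leqnn _)) /eqP ->.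
  by rewrite size_map size_s.
- split; first by rewrite map_inj_in_uniq //; apply: pt_star_inj.
  by move=> _ /mapP[k sk ->]; apply: is_point_pt; apply: contraNneq s'i => ->.
- by rewrite size_map size_s dimH.
Qed.

Lemma pt_star_face i s W :
  i \notin s -> uniq s -> size s = n.+1 -> is_face (map (pt i) s) W ->
  exists r, [/\ uniq r, {subset r <= s}, size r = n
              & W = <<[seq g i - g k | k <- r]>>%VS].
Proof.
move=> s'i uniq_s size_s [t [uniq_t sub_t]]; rewrite size_map size_s => -[size_t] ->.
(* A face is given by a list of points; [r] recovers the indices of these points, uniquely since
   [pt i] is injective on [s]. *)
pose r := [seq k <- s | pt i k \in t].
have sub_r : {subset r <= s} by move=> k; rewrite mem_filter => /andP[].
have uniq_r : uniq r by rewrite filter_uniq.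
have tE : perm_eq t (map (pt i) r).
  apply: uniq_perm => //.
    by rewrite map_inj_in_uniq // => k l /sub_r sk /sub_r sl; apply: pt_star_inj sk sl.
  move=> P; apply/idP/mapP => [tP|[k]].
    have /mapP[k sk PE] := sub_t P tP; exists k => //.
    by rewrite mem_filter sk -PE tP.
  by rewrite mem_filter => /andP[tk _] ->.
exists r; split=> //; first by have := perm_size tE; rewrite size_map size_t.
by rewrite -generated_pt /generated (perm_big _ tE).
Qed.

Lemma pt_stars_no_common_faces i j s :
  i != j -> i \notin s -> j \notin s -> uniq s -> size s = n.+1 ->
  no_common_faces (map (pt i) s) (map (pt j) s).
Proof.
move=> ij s'i s'j uniq_s size_s W.
case/(pt_star_face s'i uniq_s size_s) => r [uniq_r sub_r size_r Wi].
case/(pt_star_face s'j uniq_s size_s) => r' [uniq_r' sub_r' size_r' Wj].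
(* Two disjoint lists of n indices inside [s] would force 2n <= n+1, impossible for n >= 2. *)
have [m rm r'm] : exists2 m, m \in r & m \in r'.
  apply/hasP; rewrite has_sym; apply: contraT => disj.
  have: (size (r ++ r') <= size s)%N.
    apply: uniq_leq_size; first by rewrite cat_uniq uniq_r uniq_r' disj.
    by move=> k; rewrite mem_cat => /orP[/sub_r|/sub_r'].
  by rewrite size_cat size_r size_r' size_s -addn1 leq_add2l leqNgt n_ge2.
have /negP : g j \notin <<map g (i :: r)>>%VS.
  apply: arc_notin_span; rewrite /= ?size_r //.
  by rewrite inE negb_or eq_sym ij; apply: contra s'j => /sub_r.
case.
(* [W] is spanned by differences from [g i], so it lies in the span of [g i] and the [g k] for [k]
   in [r]. As [W] also contains [g j - g m], adding [g m] puts [g j] in that span. *)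
have Wr : {subset W <= <<map g (i :: r)>>%VS}.
  rewrite /= -span_cons_sub -map_comp Wi; apply: subvP.
  by rewrite [in X in (_ <= X)%VS]span_cons addvSr.
rewrite -(subrK (g m) (g j)); apply: memvD.
  by apply: Wr; rewrite Wj memv_span // (map_f (fun k => g j - g k)).
by rewrite memv_span // map_f // inE rm orbT.
Qed.

Lemma pt_stars_perspective i j (s : (n.+1).-tuple 'I_n.+3) :
  i != j -> i \notin s -> j \notin s -> uniq s ->
  vertex_of_perspectivity (pt i j) (map_tuple (pt i) s) (map_tuple (pt j) s).
Proof.
move=> ij s'i s'j uniq_s; split; first exact: is_point_pt.
have neq (a : 'I_n.+1) l : l \notin s -> tnth s a != l.
  by apply: contraNneq => <-; apply: mem_tnth.
exists (fun a => <<[seq g i - g l | l <- [:: j; tnth s a]]>>%VS); split.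
  (* Equal lines for distinct entries of [s] would put one representative in the span of [g i],
     [g j] and the other one, although four arc representatives are independent. *)
  move=> a b eqL; apply: (tuple_uniqP s uniq_s); apply/eqP; apply: contraT => ab.
  have /negP : g (tnth s a) \notin <<map g [:: i; j; tnth s b]>>%VS.
    by apply: arc_notin_span; rewrite // !inE !negb_or ab !neq.
  case; rewrite /= -(subKr (g i) (g (tnth s a))); apply: memvB.
    by rewrite memv_span ?mem_head.
  have: g i - g (tnth s a) \in <<[seq g i - g m | m <- [:: j; tnth s b]]>>%VS.
    by rewrite -eqL memv_span // !inE eqxx orbT.
  apply: subvP; apply/span_subvP => _ /mapP[m jlm ->].
  apply: memvB; first by rewrite memv_span ?mem_head.
  by rewrite memv_span //; move: jlm; rewrite !inE => /orP[]/eqP->; rewrite eqxx ?orbT.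
move=> a; rewrite !tnth_map -!memvE /is_line; split.
- apply/eqP; apply: free_arc_sub; rewrite ?ltnS ?(ltnW n_ge2) //.
    by rewrite !inE negb_or ij eq_sym neq.
  by rewrite /= inE eq_sym neq.
- by rewrite memv_span ?mem_head.
- by rewrite memv_span // !inE eqxx orbT.
- rewrite -(subrKA (g i)) -[g j - g i]opprB memvD ?memvN ?memv_span //= ?mem_head //.
  by rewrite !inE eqxx orbT.
Qed.

Lemma pt_stars_no_common_points i j s :
  i != j -> i \notin s -> j \notin s ->
  no_common_points (map (pt i) s) (map (pt j) s).
Proof.
move=> ij s'i s'j _ /mapP[k sk ->]; apply/negP => /mapP[l sl eq_p].
have ik : i != k by apply: contraNneq s'i => ->.
have := pt_mem ik eq_p; rewrite !inE (negPf ij) => /eqP il.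
by move: s'i; rewrite il sl.
Qed.

(** By symmetry of [pt] the increasing pairs already give every point, and by [pt_inj] they give
    each only once. *)
Lemma card_pts :
  (#|` [fset pt p.1 p.2 | p : 'I_n.+3 * 'I_n.+3 & p.1 != p.2]|%fset
     = 'C(n.+3, 2))%N.
Proof.
pose q (p : 'I_n.+3 * 'I_n.+3) := pt p.1 p.2.
pose lt_pairs := enum [pred p : 'I_n.+3 * 'I_n.+3 | (p.1 < p.2)%N].
have -> : [fset pt p.1 p.2 | p : 'I_n.+3 * 'I_n.+3 & p.1 != p.2]%fset
            = [fset P in map q lt_pairs]%fset.
  apply/fsetP => P; rewrite in_fset; apply/imfsetP/mapP => -[p].
    rewrite inE /= neq_ltn => /orP[lt_p|gt_p] ->; first by exists p; rewrite ?mem_enum.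
    by exists (p.2, p.1); rewrite ?mem_enum // /q pt_sym.
  rewrite mem_enum inE => lt_p ->; exists p => //.
  by rewrite inE /= neq_ltn lt_p.
rewrite card_fseq undup_id; first by rewrite size_map -cardE card_ord_pairs.
rewrite map_inj_in_uniq ?enum_uniq // => -[i j] [k l].
rewrite !mem_enum !inE /= => ij kl /pt_inj.
rewrite neq_ltn ij => /(_ isT)/orP[/eqP //|/eqP[iE jE]].
by move: kl; rewrite -iE -jE ltnNge (ltnW ij).
Qed.

End ArcDifferences.

(** * Vector representatives of the arc, normalised relative to H *)

Section NormalisedArc.

Local Open Scope ring_scope.

Variables (F : fieldType) (V : vectType F) (n : nat) (H : {vspace V}).

Lemma arc_free (G : (n.+3).-tuple {vspace V}) (g : 'I_n.+3 -> V) :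
  \dim {:V} = n.+2 -> is_arc fullv G -> (forall i, tnth G i = <[g i]>%VS) ->
  forall s, uniq s -> (size s <= n.+2)%N -> free (map g s).
Proof.
move=> dimV [[uniq_G _] _ simplexG] GE s uniq_s le_s.
pose r := take (n.+2 - size s) (filter [predC s] (enum 'I_n.+3)).
have sub_r k : k \in r -> k \notin s by move=> /mem_take; rewrite mem_filter => /andP[].
have uniq_sr : uniq (s ++ r).
  rewrite cat_uniq uniq_s [uniq r]take_uniq; last exact/filter_uniq/enum_uniq.
  by rewrite andbT; apply/hasPn => k /sub_r.
have size_sr : size (s ++ r) = n.+2.
  rewrite size_cat size_takel ?subnKC // size_filter.
  have := count_predC (mem s) (enum 'I_n.+3); rewrite size_enum_ord.
  have -> : count (mem s) (enum 'I_n.+3) = size s.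
    rewrite -size_filter; apply/perm_size/uniq_perm => //.
      exact/filter_uniq/enum_uniq.
    by move=> k; rewrite mem_filter mem_enum andbT.
  by move=> eq_n; rewrite leq_subLR eq_n.
have [] := simplexG (map (tnth G) (s ++ r)).
- by rewrite map_inj_uniq //; apply/tuple_uniqP.
- by move=> _ /mapP[k _ ->]; apply: mem_tnth.
- by rewrite size_map size_sr dimV.
move=> _ _ genE; apply: (@catl_free _ _ (map g r)); rewrite -map_cat /free.
suff -> : <<map g (s ++ r)>>%VS = fullv by rewrite dimV size_map size_sr.
by rewrite -genE span_def /generated !big_map; apply: eq_bigr => k _; rewrite GE.
Qed.

Lemma normalised_representatives (I : finType) (P : I -> {vspace V}) :
  \dim {:V} = (\dim H).+1 -> (forall i, is_point (P i)) ->
  (forall i, ~~ (P i <= H)%VS) ->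
  exists g : I -> V, [/\ forall i, P i = <[g i]>%VS, forall i, g i \notin H
                       & forall i j, g i - g j \in H].
Proof.
move=> dimV ptP notH.
(* All representatives will be chosen in the single coset [v + H], which makes their differences lie
   in [H]. *)
have [v H'v] : exists v, v \notin H.
  have : ~~ (fullv <= H)%VS by apply: contraL (leqnn (\dim H)) => /dimvS; rewrite dimV -ltnNge.
  by case/subvPn => v _ H'v; exists v.
have full : (<[v]> + H)%VS = fullv.
  apply/eqP; rewrite eqEdim subvf dimV dimv_disjoint_sum ?dim_vline.
    have -> : v != 0 by apply: contraNneq H'v => ->; rewrite mem0v.
    by rewrite add1n leqnn.
  apply/eqP; rewrite -subv0; apply/subvP => u /memv_capP[/vlineP[a ->]].
  by rewrite rpredZeq (negPf H'v) orbF => /eqP ->; rewrite scale0r mem0v.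
have repr i : exists u, P i = <[u]>%VS /\ u - v \in H.
  have [w Pw H'w] := subvPn (notH i).
  have : w \in (<[v]> + H)%VS by rewrite full memvf.
  case/memv_addP => _ /vlineP[a ->] [h Hh wE].
  have a_neq0 : a != 0 by apply: contraNneq H'w => a0; rewrite wE a0 scale0r add0r.
  (* Since [w = a *: v + h] with [a] nonzero, this scaling makes the coefficient of [v] equal to
     1. *)
  exists (a^-1 *: w); split; last first.
    by rewrite wE scalerDr scalerA mulVf // scale1r addrAC subrr add0r memvZ.
  apply/esym/eqP; rewrite eqEdim -memvE memvZ // (ptP i) dim_vline.
  have -> // : a^-1 *: w != 0.
  by rewrite scaler_eq0 invr_eq0 (negPf a_neq0); apply: contraNneq H'w => ->; rewrite mem0v.
have [g gE] := fin_all_exists repr.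
exists g; split=> [i|i|i j]; first by case: (gE i).
- by have [PE _] := gE i; rewrite memvE -PE.
- by have [[_ Hi] [_ Hj]] := (gE i, gE j); rewrite -(subrKA v) -(opprB (g j) v) memvB.
Qed.

End NormalisedArc.

(** * The configuration cut out on H *)

Lemma config_point_line (F : fieldType) (V : vectType F) (H : {vspace V}) k
    (G : k.-tuple {vspace V}) (g : 'I_k -> V) :
  (forall i, tnth G i = <[g i]>%VS) -> (forall i, g i \notin H) ->
  (forall i j, (g i - g j)%R \in H) ->
  forall i j, config_point H G i j = <[(g i - g j)%R]>%VS.
Proof.
move=> GE notH subH i j; rewrite /config_point !GE; apply/eqP; rewrite eqEsubv.
apply/andP; split; last first.
  by rewrite -memvE memv_cap subH andbT memv_add ?memvN ?memv_line.
apply/subvP => _ /memv_capP[/memv_addP[_ /vlineP[a ->] [_ /vlineP[b ->] ->]]] Hu.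
apply/vlineP; exists a.
(* Modulo [H] the vectors [g i] and [g j] agree, so a combination lying in [H] has [a + b = 0], as
   [g j] is outside [H]. *)
have : ((a + b) *: g j)%R \in H.
  have -> : ((a + b) *: g j = a *: g i + b *: g j - a *: (g i - g j))%R.
    by rewrite scalerBr opprD opprK addrACA subrr add0r -scalerDl addrC.
  by rewrite memvB // memvZ.
rewrite rpredZeq (negPf (notH j)) orbF => /eqP ab0.
by rewrite -(addr0_eq ab0) scalerBr scaleNr.
Qed.

Theorem theorem9p1 (n : nat) (F : fieldType) (V : vectType F)
    (H : {vspace V}) (G : (n.+3).-tuple {vspace V}) :
  2 <= n ->
  (exists s : seq F, uniq s /\ 2 < size s) ->
  \dim (fullv : {vspace V}) = n.+2 ->
  \dim H = n.+1 ->
  is_arc fullv G ->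
  (forall i : 'I_n.+3, ~~ (tnth G i <= H)%VS) ->
  #|` configuration H G|%fset = 'C(n.+3, 2) /\
  (forall i j : 'I_n.+3, i != j ->
     exists A B : (n.+1).-tuple {vspace V},
       [/\ is_simplex H A, is_simplex H B,
           vertex_of_perspectivity (config_point H G i j) A B,
           no_common_points A B & no_common_faces A B]).
Proof.
move=> n_ge2 _ dimV dimH arcG notH.
have ptG i : is_point (tnth G i) by case: arcG => -[_ ptG] _ _; apply/ptG/mem_tnth.
have [|g [GE H'g subH]] := normalised_representatives _ ptG notH.
  by rewrite dimV dimH.
have free_g := arc_free dimV arcG GE.
have cfgE := config_point_line GE H'g subH.
split=> [|i j ij].
  rewrite -(card_pts n_ge2 free_g) /configuration; congr #|` _|%fset.
  by apply/fsetP => P; apply/imfsetP/imfsetP => -[p ? ->]; exists p; rewrite ?cfgE.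
(* Both simplexes are indexed by the n+1 arc points other than [i] and [j], in the same order, so
   that corresponding vertices share an index. *)
have sizeI : size (enum [predC [:: i; j]]) == n.+1.
  have uniq_ij : uniq [:: i; j] by rewrite /= inE ij.
  have := cardC (mem [:: i; j]).
  by rewrite (card_uniqP uniq_ij) card_ord -cardE => -[eq_n]; apply/eqP.
pose s := Tuple sizeI; have uniq_s : uniq s := enum_uniq _.
have [s'i s'j] : i \notin s /\ j \notin s by rewrite !mem_enum !inE !eqxx orbT.
have size_s := size_tuple s.
exists (map_tuple (fun k => <[(g i - g k)%R]>%VS) s).
exists (map_tuple (fun k => <[(g j - g k)%R]>%VS) s); rewrite cfgE; split.
- exact: pt_star_simplex.
- exact: pt_star_simplex.
- exact: pt_stars_perspective.
- exact: pt_stars_no_common_points.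
- exact: pt_stars_no_common_faces.
Qed.
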